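(* There is a family $\mathcal{F}=\{(\mathcal{M}_n,\mathcal{N}_n)\mid n\in\mathbb{N}_{\ge 1}\}$ of pairs of finite LMCs such that, for all $n\in\mathbb{N}_{\ge1}$ and $\varepsilon\in\left(0,\frac{1}{n\cdot(n+1)^2}\right]$, $\mathcal{M}_n$ and $\mathcal{N}_n$ are graph-isomorphic and $\varepsilon$-bisimilar, but $\mathcal{M}_n\not\simeq_\delta\mathcal{N}_n$ for any $\delta<n\varepsilon$.
   Context: Fix a countable set $AP$ of atomic propositions. A labeled Markov chain (LMC) $\mathcal{M}=(S,P,s_{init},l)$ has a countable nonempty state set $S$, a transition function $P\colon S\to Distr(S)$ ($Distr(S)$ is the set of probability distributions on $S$), an initial state $s_{init}\in S$ and a labeling $l\colon S\to 2^{AP}$. It is finite if $S$ is finite. For $A\subseteq S$, $P(s)(A)=\sum_{t\in A}P(s)(t)$. The direct sum $\mathcal{M}\oplus\mathcal{N}$ is the LMC on the disjoint union of the state spaces with inherited transitions and labels (its initial state is irrelevant). Two LMCs are graph-isomorphic if their underlying directed graphs (an edge $s\to t$ whenever $P(s)(t)>0$) are isomorphic. For $R\subseteq S\times S$ and $A\subseteq S$ let $R(A)=\{t\mid\exists s\in A\colon(s,t)\in R\}$. A reflexive and symmetric $R$ is an $\varepsilon$-bisimulation if for all $(s,t)\in R$ and all $A\subseteq S$: $l(s)=l(t)$ and $P(s)(A)\le P(t)(R(A))+\varepsilon$. $s\sim_\varepsilon t$ if $(s,t)\in R$ for some $\varepsilon$-bisimulation $R$; $\mathcal{M}$ and $\mathcal{N}$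 are $\varepsilon$-bisimilar, $\mathcal{M}\sim_\varepsilon\mathcal{N}$, if $s_{init}^{\mathcal{M}}\sim_\varepsilon s_{init}^{\mathcal{N}}$ in $\mathcal{M}\oplus\mathcal{N}$. An equivalence $R\subseteq S\times S$ is a (probabilistic) bisimulation on $\mathcal{M}$ if for all $(s,t)\in R$ and all $R$-equivalence classes $C$: $l(s)=l(t)$ and $P(s)(C)=P(t)(C)$. For $\delta\ge0$, a $\delta$-perturbation of $\mathcal{M}=(S,P,s_{init},l)$ is an LMC $\mathcal{M}'=(S,P',s_{init},l)$ with $\|P(s)-P'(s)\|_1=\sum_{t\in S}|P(s)(t)-P'(s)(t)|\le\delta$ for all $s\in S$. An equivalence $R$ on $S$ is a $\delta$-perturbed bisimulation on $\mathcal{M}$ if there is a $\delta$-perturbation $\mathcal{M}'$ of $\mathcal{M}$ such that $R$ is a bisimulation on $\mathcal{M}'$. $s\simeq_\delta t$ if $(s,t)\in R$ for some $\delta$-perturbed bisimulation $R$; $\mathcal{M}\simeq_\delta\mathcal{N}$ if $s_{init}^{\mathcal{M}}\simeq_\delta s_{init}^{\mathcal{N}}$ in $\mathcal{M}\oplus\mathcal{N}$.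
   Formalization: The transition probabilities of M_n and N_n may depend on ε (state spaces depend only on n), since a family of finite LMCs independent of ε would be bisimilar, contradicting δ=0; and AP is assumed nonempty, since otherwise all states are bisimilar. *)

(* Defs.v *)
From HB Require Import structures.
From Corelib Require Export RelationClasses.
From mathcomp Require Export all_boot all_order all_algebra.
From mathcomp Require Export boolp classical_sets functions cardinality reals.
From mathcomp Require Export ereal esum.

Set Implicit Arguments.
Unset Strict Implicit.
Unset Printing Implicit Defensive.

Import Order.TTheory GRing.Theory Num.Theory.
Local Open Scope classical_set_scope.
Local Open Scope ring_scope.

Record distr (R : realType) (S : countType) := Distr {
  pmf :> S -> R;
  pmf_ge0 : forall s, 0 <= pmf s;
  pmf_sum1 : (\esum_(s in [set: S]) (pmf s)%:E = 1)%E }.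

(* [prob mu A] is extended-real valued only because [esum] is; it is at most 1. *)
Definition prob (R : realType) (S : countType) (mu : distr R S) (A : set S) :
    \bar R :=
  (\esum_(s in A) (mu s)%:E)%E.

Definition l1dist (R : realType) (S : countType) (mu nu : distr R S) : \bar R :=
  (\esum_(s in [set: S]) `|mu s - nu s|%:E)%E.

Lemma esum_inj_extend (R : realType) (S T : countType) (f : S -> T)
    (mu : S -> R) (nu : T -> R) :
  injective f -> (forall t, 0 <= nu t) ->
  (forall s, nu (f s) = mu s) -> (forall t, ~ range f t -> nu t = 0) ->
  (\esum_(t in [set: T]) (nu t)%:E = \esum_(s in [set: S]) (mu s)%:E)%E.
Proof.
move=> finj nu0 nuf nuN.
rewrite (esumID (range f)); last by move=> t _; rewrite lee_fin.
rewrite !setTI [X in (_ + X)%E]esum1 ?adde0; last first.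
  by move=> t /= /nuN ->.
rewrite esum_image; last by move=> x y _ _; exact: finj.
by apply: eq_esum => s _; rewrite nuf.
Qed.

Section DistrSum.
Context (R : realType) (S T : countType).

Definition inl_pmf (mu : S -> R) (x : S + T) : R :=
  match x with inl s => mu s | inr _ => 0 end.
Definition inr_pmf (mu : T -> R) (x : S + T) : R :=
  match x with inl _ => 0 | inr t => mu t end.

Lemma inl_pmf_ge0 (mu : distr R S) x : 0 <= inl_pmf mu x.
Proof. by case: x => [s|t] //=; exact: pmf_ge0. Qed.

Lemma inr_pmf_ge0 (mu : distr R T) x : 0 <= inr_pmf mu x.
Proof. by case: x => [s|t] //=; exact: pmf_ge0. Qed.

Lemma inl_pmf_sum1 (mu : distr R S) :
  (\esum_(x in [set: (S + T)%type]) (inl_pmf mu x)%:E = 1)%E.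
Proof.
rewrite -(pmf_sum1 mu); apply: (@esum_inj_extend _ _ _ (@inl S T)) => //.
- by move=> x y [].
- exact: inl_pmf_ge0.
- by move=> [s|t] //= h; exfalso; apply: h; exists s.
Qed.

Lemma inr_pmf_sum1 (mu : distr R T) :
  (\esum_(x in [set: (S + T)%type]) (inr_pmf mu x)%:E = 1)%E.
Proof.
rewrite -(pmf_sum1 mu); apply: (@esum_inj_extend _ _ _ (@inr S T)) => //.
- by move=> x y [].
- exact: inr_pmf_ge0.
- by move=> [s|t] //= h; exfalso; apply: h; exists t.
Qed.

Definition inl_distr (mu : distr R S) : distr R (S + T)%type :=
  Distr (inl_pmf_ge0 mu) (inl_pmf_sum1 mu).
Definition inr_distr (mu : distr R T) : distr R (S + T)%type :=
  Distr (inr_pmf_ge0 mu) (inr_pmf_sum1 mu).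

End DistrSum.

(* The state space is nonempty because of [init]. *)
Record lmc (R : realType) (AP : countType) (S : countType) := LMC {
  trans : S -> distr R S;
  init : S;
  label : S -> set AP }.

Section LMC.
Context (R : realType) (AP : countType).

Definition direct_sum (S T : countType) (M : lmc R AP S) (N : lmc R AP T) :
    lmc R AP (S + T)%type :=
  {| trans := fun x => match x with
       | inl s => inl_distr T (trans M s)
       | inr t => inr_distr S (trans N t)
       end;
     init := inl (init M);
     label := fun x => match x with
       | inl s => label M s
       | inr t => label N t
       end |}.

Definition edge (S : countType) (M : lmc R AP S) (s t : S) : Prop :=
  0 < trans M s t.

Definition graph_isomorphic (S T : countType)
    (M : lmc R AP S) (N : lmc R AP T) : Prop :=
  exists f : S -> T,
    bijective f /\ forall s s', edge M s s' <-> edge N (f s) (f s').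

Definition rel_image (S : Type) (Rel : S -> S -> Prop) (A : set S) : set S :=
  [set t | exists2 s, A s & Rel s t].

Definition eps_bisimulation (S : countType) (M : lmc R AP S) (eps : R)
    (Rel : S -> S -> Prop) : Prop :=
  [/\ Reflexive Rel, Symmetric Rel &
      forall s t, Rel s t -> forall A : set S,
        label M s = label M t /\
        (prob (trans M s) A
           <= prob (trans M t) (rel_image Rel A) + eps%:E)%E].

Definition eps_similar (S : countType) (M : lmc R AP S) (eps : R)
    (s t : S) : Prop :=
  exists2 Rel, eps_bisimulation M eps Rel & Rel s t.

Definition eps_bisimilar (S T : countType) (M : lmc R AP S) (N : lmc R AP T)
    (eps : R) : Prop :=
  eps_similar (direct_sum M N) eps (inl (init M)) (inr (init N)).

Definition equiv_class (S : Type) (Rel : S -> S -> Prop) (C : set S) : Prop :=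
  exists x, C = [set y | Rel x y].

Definition bisimulation (S : countType) (M : lmc R AP S)
    (Rel : S -> S -> Prop) : Prop :=
  Equivalence Rel /\
  forall s t, Rel s t -> forall C, equiv_class Rel C ->
    label M s = label M t /\ prob (trans M s) C = prob (trans M t) C.

Definition perturbation (S : countType) (delta : R) (M M' : lmc R AP S) : Prop :=
  [/\ init M' = init M, label M' = label M &
      forall s, (l1dist (trans M s) (trans M' s) <= delta%:E)%E].

Definition perturbed_bisimulation (S : countType) (M : lmc R AP S) (delta : R)
    (Rel : S -> S -> Prop) : Prop :=
  Equivalence Rel /\
  exists2 M', perturbation delta M M' & bisimulation M' Rel.

Definition perturbed_similar (S : countType) (M : lmc R AP S) (delta : R)
    (s t : S) : Prop :=
  exists2 Rel, perturbed_bisimulation M delta Rel & Rel s t.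

Definition perturbed_bisimilar (S T : countType) (M : lmc R AP S)
    (N : lmc R AP T) (delta : R) : Prop :=
  perturbed_similar (direct_sum M N) delta (inl (init M)) (inr (init N)).

End LMC.

(* Main.v *)
(* Both chains branch from their initial state into states 0, ..., n, and state
   i moves to an absorbing state with its own label with probability i * eps
   and to another absorbing state otherwise.  One chain branches uniformly, with
   weights (n+1)/(n+1)^2, the other with weights (n+2)/(n+1)^2 for i < n and
   1/(n+1)^2 for i = n.  The two branchings can be coupled so that mass only
   moves between neighbouring indices, whence eps-bisimilarity.  But no proper
   nonempty subset sum of the second weights is a subset sum of the first ones,
   and the resulting gap of at least 1/(n+1)^2 exceeds delta; so a perturbed
   bisimulation has one class containing all states 0, ..., n of the second
   chain, and equating states 0 and n costs at least n * eps. *)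
Require Import Defs.
From mathcomp Require Import fsbigop.
From mathcomp Require Import ring lra zify.
Import Order.TTheory GRing.Theory Num.Theory.
Local Open Scope ring_scope.

Set Implicit Arguments.
Unset Strict Implicit.
Unset Printing Implicit Defensive.

(** * Distributions on finite sets *)

Section FiniteDistr.
Context (R : realType).

Lemma esum_fin (S : finType) (f : S -> R) (A : set S) :
  (forall s, 0 <= f s) ->
  (\esum_(s in A) (f s)%:E = (\sum_(s | s \in A) f s)%:E)%E.
Proof.
move=> f0; rewrite esum_fset; last by move=> s _; rewrite lee_fin.
  rewrite (fsbigE [seq s <- enum S | s \in A]).
  - rewrite big_filter_cond big_enum_cond /= -sumEFin.
    by apply: eq_bigl => s; rewrite andbb.
  - by rewrite filter_uniq // enum_uniq.
  - by move=> s /=; rewrite mem_filter => /andP[/set_mem].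
  - by move=> s As; rewrite mem_filter mem_enum inE (mem_set As).
exact: finite_finset.
Qed.

Lemma prob_fin (S : finType) (mu : distr R S) (A : set S) :
  prob mu A = (\sum_(s | s \in A) mu s)%:E.
Proof. by apply: esum_fin => s; exact: pmf_ge0. Qed.

Lemma pmf_sum1_fin (S : finType) (mu : distr R S) : \sum_s mu s = 1.
Proof.
have := pmf_sum1 mu; rewrite esum_fin; last exact: pmf_ge0.
by move=> [<-]; apply: eq_bigl => s; rewrite in_setT.
Qed.

(** Both masses total 1, so what is gained on [A] is lost on its complement: the same difference is
    paid twice in the l1 distance. *)
Lemma prob_l1dist (S : finType) (mu nu : distr R S) (A : set S) (delta : R) :
  (l1dist mu nu <= delta%:E)%E ->
  `|\sum_(s | s \in A) mu s - \sum_(s | s \in A) nu s| *+ 2 <= delta.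
Proof.
rewrite /l1dist esum_fin // lee_fin => /(le_trans _); apply.
rewrite [leRHS](eq_bigl xpredT); last by move=> s; rewrite in_setT.
have split1 (m : distr R S) :
    \sum_(s | s \in A) m s = 1 - \sum_(s | s \notin A) m s.
  by rewrite -(pmf_sum1_fin m) [in RHS](bigID (mem A)) /= addrK.
rewrite [leRHS](bigID (mem A)) /= mulr2n lerD //.
  by rewrite -sumrB ler_norm_sum.
rewrite !split1 opprB addrC addrA subrK -sumrB.
by under [leRHS]eq_bigr do rewrite distrC; exact: ler_norm_sum.
Qed.

End FiniteDistr.

(** * Direct sums and perturbed bisimulations of finite chains *)

Section DirectSum.
Context (R : realType) (AP : countType) (S T : finType).
Context (M : lmc R AP S) (N : lmc R AP T).

Lemma sum_direct_sum_inl (s : S) (P : pred (S + T)) :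
  \sum_(x | P x) trans (direct_sum M N) (inl s) x =
    \sum_(y | P (inl y)) trans M s y.
Proof. by rewrite big_sumType/= [X in _ + X]big1 ?addr0. Qed.

Lemma sum_direct_sum_inr (t : T) (P : pred (S + T)) :
  \sum_(x | P x) trans (direct_sum M N) (inr t) x =
    \sum_(y | P (inr y)) trans N t y.
Proof. by rewrite big_sumType/= [X in X + _]big1 ?add0r. Qed.

Lemma prob_direct_sum_inl (s : S) (A : set (S + T)) :
  prob (trans (direct_sum M N) (inl s)) A = prob (trans M s) (inl @^-1` A).
Proof. by rewrite !prob_fin sum_direct_sum_inl. Qed.

Lemma prob_direct_sum_inr (t : T) (A : set (S + T)) :
  prob (trans (direct_sum M N) (inr t)) A = prob (trans N t) (inr @^-1` A).
Proof. by rewrite !prob_fin sum_direct_sum_inr. Qed.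

End DirectSum.

(** Perturbing each of the two rows moves the mass of [C] by at most [delta / 2], and the perturbed
    masses agree. *)
Lemma perturbed_bisimulation_prob (R : realType) (AP : countType) (S : finType)
    (M : lmc R AP S) (delta : R) (Rel : S -> S -> Prop) (s t : S) (C : set S) :
  perturbed_bisimulation M delta Rel -> Rel s t -> equiv_class Rel C ->
  `|\sum_(x | x \in C) trans M s x - \sum_(x | x \in C) trans M t x| <= delta.
Proof.
move=> [_ [M' [_ _ MM'] [_ bis]]] st CR.
have [_] := bis _ _ st _ CR; rewrite !prob_fin => -[eqst].
have Ms := prob_l1dist C (MM' s).
have Mt := prob_l1dist C (MM' t).
rewrite eqst in Ms; rewrite distrC in Mt.
apply: le_trans (ler_distD (\sum_(u | u \in C) trans M' t u) _ _) _.
by move: Ms Mt; rewrite !mulr2n; lra.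
Qed.

Lemma perturbed_bisimulation_label (R : realType) (AP : countType) (S : finType)
    (M : lmc R AP S) (delta : R) (Rel : S -> S -> Prop) (s t : S) :
  perturbed_bisimulation M delta Rel -> Rel s t -> label M s = label M t.
Proof.
move=> [_ [M' [_ <- _] [_ bis]]] st.
by have [] := bis _ _ st _ (ex_intro _ s erefl).
Qed.

(** * Branching weights and their coupling *)

Section Weights.
Local Open Scope nat_scope.

(** Numerators over the common denominator [n.+1 ^ 2], kept in [nat] for the divisibility
    argument. *)
Definition weight n (side : bool) (j : 'I_n.+1) : nat :=
  if side then n.+1 else 1 + (j < n) * n.+1.

Lemma weight_gt0 n side j : 0 < @weight n side j.
Proof. by case: side. Qed.

Lemma sum_weight n side : \sum_j @weight n side j = n.+1 ^ 2.
Proof.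
case: side; rewrite /weight; first by rewrite sum_nat_const card_ord.
rewrite big_split/= sum1_card card_ord big_ord_recr/= ltnn mul0n addn0.
under eq_bigr do rewrite ltn_ord mul1n.
rewrite sum_nat_const card_ord; lia.
Qed.

(** The easy half of Strassen's theorem: all mass of the rows in [A] lands in columns in [B]. *)
Lemma sum_coupling_le (I J : finType) (c : I -> J -> nat)
    (A : pred I) (B : pred J) :
  (forall i j, A i -> 0 < c i j -> B j) ->
  \sum_(i | A i) \sum_j c i j <= \sum_(j | B j) \sum_i c i j.
Proof.
move=> AB; rewrite exchange_big/= [leqRHS]big_mkcond/=.
apply: leq_sum => j _; case: ifP => [_|nBj].
  by rewrite [leqRHS](bigID A)/= leq_addr.
rewrite big1// => i Ai; apply/eqP; rewrite -leqn0 leqNgt.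
by apply/negP => /(AB _ _ Ai); rewrite nBj.
Qed.

(* Overlaps of the partitions of [0, n.+1 ^ 2] into consecutive intervals of
   lengths [weight true] and [weight false]. *)
Definition coupling n (i j : 'I_n.+1) : nat :=
  (if i == j then n.+1 - i else 0) + (if i == j.+1 :> nat then i : nat else 0).

Lemma coupling_row n i : \sum_j @coupling n i j = weight true i.
Proof.
rewrite big_split/= -!big_mkcond/= (big_pred1 i); last first.
  by move=> j; rewrite /= eq_sym.
case: i => -[|k] ki /=; first by rewrite big1 // subn0 addn0.
rewrite (big_pred1 (Ordinal (ltnW ki))); last first.
  by move=> j; rewrite /= eqSS -val_eqE /= eq_sym.
rewrite /weight; lia.
Qed.

Lemma coupling_col n j : \sum_i @coupling n i j = weight false j.
Proof.
rewrite big_split/= -!big_mkcond/= (big_pred1 j)// /weight.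
have [jn|nj] := ltnP j n.
  rewrite (big_pred1 (Ordinal (jn : j.+1 < n.+1)))/=; first lia.
  by move=> i; rewrite /= -val_eqE.
(* For [j = n] there is no row [j.+1]; the diagonal entry [n.+1 - n = 1] remains. *)
rewrite big_pred0; last by move=> i; have := ltn_ord i; lia.
have := ltn_ord j; lia.
Qed.

Lemma coupling_gt0 n i j : 0 < @coupling n i j -> j <= i <= j.+1.
Proof. by rewrite /coupling -val_eqE/=; do 2 case: eqP; lia. Qed.

Lemma sum_weight_le n s s' (A B : pred 'I_n.+1) :
  (forall i j : 'I_n.+1, A i -> i <= j.+1 -> j <= i.+1 -> B j) ->
  \sum_(i | A i) weight s i <= \sum_(j | B j) weight s' j.
Proof.
move=> AB.
have AsubB i : A i -> B i by move=> Ai; apply: (AB i).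
have [->|ss'] := eqVneq s s'.
  rewrite [leqRHS](bigID A)/= -[leqLHS]addn0 leq_add// (eq_bigl A)// => i.
  by case: (boolP (A i)) => [/AsubB ->|]; rewrite ?andbF.
case: s s' ss' => -[]// _.
- under eq_bigr do rewrite -coupling_row.
  under [leqRHS]eq_bigr do rewrite -coupling_col.
  by apply: sum_coupling_le => i j Ai /coupling_gt0 ij; apply: (AB i) => //; lia.
- under eq_bigr do rewrite -coupling_col.
  under [leqRHS]eq_bigr do rewrite -coupling_row.
  apply: (sum_coupling_le (c := fun j i => coupling i j)) => i j Ai /coupling_gt0 ij.
  by apply: (AB i) => //; lia.
Qed.

(* Modulo [n.+1], a [weight false]-sum counts its indices and a
   [weight true]-sum vanishes. *)
Lemma sum_weight_eq n (A B : pred 'I_n.+1) j :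
  \sum_(i | A i) weight true i = \sum_(i | B i) weight false i ->
  B j -> forall i, B i.
Proof.
rewrite /weight sum_nat_const big_split/= sum1_card -big_distrl/= => eqAB Bj i.
have Bgt0 : 0 < #|B| by apply/card_gt0P; exists j.
have Bdvd : n.+1 %| #|B|.
  have dvdm := dvdn_mull (\sum_(i | B i) (i < n)) (dvdnn n.+1).
  by rewrite -(dvdn_addl _ dvdm) -eqAB dvdn_mull.
(* A positive multiple of [n.+1] that is at most [n.+1] equals it. *)
have cardB : #|B| = #|'I_n.+1|.
  by apply/eqP; rewrite eqn_leq max_card card_ord dvdn_leq.
by have := subset_cardP cardB (subset_predT B) i; rewrite !inE.
Qed.

End Weights.

(** * The two chains *)

Section Chain.
Context (R : realType) (AP : countType) (n : nat) (eps : R) (side : bool).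

(* [inl i] is the [i]-th intermediate state, [inr None] the initial state, and
   [inr (Some true)], [inr (Some false)] are the two absorbing states. *)
Definition state : finType := ('I_n.+1 + option bool)%type.

(* Truncated to [0, 1] only to be a probability for every [eps]. *)
Definition bias (i : 'I_n.+1) : R := Num.max 0 (Num.min 1 (i%:R * eps)).

Lemma bias_ge0 i : 0 <= bias i.
Proof. by rewrite le_max lexx. Qed.

Lemma bias_le1 i : bias i <= 1.
Proof. by rewrite ge_max ler01 ge_min lexx. Qed.

Definition step (x y : state) : R :=
  match x, y with
  | inr None, inl j => (weight side j)%:R / (n.+1 ^ 2)%:R
  | inl i, inr (Some b) => if b then bias i else 1 - bias i
  | inr (Some b), inr (Some b') => (b == b')%:R
  | _, _ => 0
  end.

Lemma sum_state (f : state -> R) (P : pred state) :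
  \sum_(x | P x) f x = \sum_(i | P (inl i)) f (inl i) +
    ((if P (inr None) then f (inr None) else 0) +
     ((if P (inr (Some true)) then f (inr (Some true)) else 0) +
      (if P (inr (Some false)) then f (inr (Some false)) else 0))).
Proof.
rewrite big_sumType/=; congr +%R.
rewrite big_mkcond /= (bigD1 None) //=; congr +%R.
rewrite (bigD1 (Some true)) //= (bigD1 (Some false)) //= big1 ?addr0 //.
by case=> [[]|].
Qed.

Lemma step_ge0 x y : 0 <= step x y.
Proof.
case: x y => [i|[b|]] [j|[b'|]] //=.
by case: b'; rewrite ?subr_ge0 ?bias_ge0 ?bias_le1.
Qed.

Lemma step_sum1 x : (\esum_(y in [set: state]) (step x y)%:E = 1)%E.
Proof.
rewrite esum_fin; last exact: step_ge0.
congr EFin; rewrite (eq_bigl xpredT); last by move=> y; rewrite in_setT.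
rewrite sum_state; case: x => [i|[b|]] /=.
- by rewrite big1//; ring.
- by rewrite big1//; case: b; rewrite /=; ring.
- rewrite -mulr_suml -natr_sum sum_weight divff ?pnatr_eq0//; ring.
Qed.

(** Only one absorbing state has a nonempty label; this separates it from the other one once [AP] is
    inhabited. *)
Definition chain : lmc R AP state :=
  {| trans := fun x => Distr (step_ge0 x) (@step_sum1 x);
     init := inr None;
     label := fun x => if x is inr (Some true) then [set: AP]%classic else set0 |}.

End Chain.
Arguments chain {R AP} n eps side.

(** * The chains are [eps]-bisimilar *)

Section EpsBisimulation.
Context (R : realType) (AP : countType) (n : nat) (eps : R).
Hypothesis eps_ge0 : 0 <= eps.

Definition close (u v : state n) : bool :=
  match u, v with
  | inl i, inl j => (i <= j.+1)%N && (j <= i.+1)%N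
  | inr a, inr b => a == b
  | _, _ => false
  end.

Lemma closexx u : close u u.
Proof. by case: u => [i|a] //=; rewrite leqnSn. Qed.

Lemma close_sym u v : close u v = close v u.
Proof. by case: u v => [i|a] [j|b] //=; rewrite andbC. Qed.

(** Truncation to [0, 1] is nondecreasing and 1-Lipschitz, so one index step still costs at most
    [eps]. *)
Lemma bias_close (i j : 'I_n.+1) :
  (i <= j.+1)%N -> bias eps i <= bias eps j + eps.
Proof.
rewrite /bias -(ler_nat R) -natr1 => ij.
have : i%:R * eps <= j%:R * eps + eps.
  by rewrite -[X in _ + X]mul1r -mulrDl ler_wpM2r.
set a := i%:R * eps; set b := j%:R * eps => ab.
rewrite ge_max addr_ge0 ?le_max ?lexx //= -lerBlDr le_max orbC lerBlDr.
by case: (leP 1 b) => _; rewrite ge_min ?lerDl ?eps_ge0 ?ab ?orbT.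
Qed.

(** The sides [s] and [s'] are independent, so this covers all pairs of states in the direct sum. *)
Lemma chain_close s s' (u v : state n) (A B : set (state n)) :
  close u v -> (forall x y, A x -> close x y -> B y) ->
  (prob (trans (chain (AP := AP) n eps s) u) A <=
   prob (trans (chain (AP := AP) n eps s') v) B + eps%:E)%E.
Proof.
move=> uv AB; rewrite !prob_fin lee_fin !sum_state.
have sub x : x \in A -> x \in B.
  by move=> /set_mem Ax; apply/mem_set/(AB x) => //; exact: closexx.
case: u v uv => [i|[b|]] [j|[b'|]] //= => [/andP[ij ji]|/eqP[<-]|_].
- rewrite !big1// !if_same !add0r.
  have := sub (inr (Some true)); have := sub (inr (Some false)).
  have := bias_close ij; have := bias_close ji.
  have := bias_ge0 eps i; have := bias_ge0 eps j.
  have := bias_le1 eps i; have := bias_le1 eps j.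
  by do 4 case: (_ \in _) => //; move=> *; try lra; exfalso; auto.
- rewrite !big1// !if_same !add0r.
  have := sub (inr (Some true)); have := sub (inr (Some false)).
  by case: b; do 4 case: (_ \in _) => //=; move: eps_ge0 => *;
     try lra; exfalso; auto.
(* Initial states: the branchings couple without loss; [eps] is spent only at the intermediate
   states. *)
- rewrite !if_same !addr0 -[leLHS]addr0 lerD //.
  rewrite -!mulr_suml ler_wpM2r ?invr_ge0// -!natr_sum ler_nat.
  apply: sum_weight_le => i j /set_mem Ai ij ji.
  by apply/mem_set/(AB _ _ Ai) => /=; rewrite ij.
Qed.

Definition strip (x : state n + state n) : state n :=
  match x with inl u => u | inr u => u end.

Lemma chain_eps_bisimilar :
  eps_bisimilar (chain (AP := AP) n eps true) (chain n eps false) eps.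
Proof.
exists (fun x y => close (strip x) (strip y)) => //; split.
- by move=> x; exact: closexx.
- by move=> x y; rewrite close_sym.
- move=> x y xy A; split.
    by case: x y xy => -[i|a] [] [j|b] //= /eqP ->.
  case: x y xy => u [] v uv;
    rewrite ?prob_direct_sum_inl ?prob_direct_sum_inr;
    by apply: chain_close uv _ => x y Ax xy; eexists; first exact: Ax.
Qed.

End EpsBisimulation.

(** * No perturbed bisimilarity below [n * eps] *)

Lemma close_fractions_eq (R : numFieldType) (a b d : nat) :
  (0 < d)%N -> `|a%:R / d%:R - b%:R / d%:R| < d%:R^-1 :> R -> a = b.
Proof.
move=> d0; rewrite -mulrBl normrM (ger0_norm (x := _^-1)) ?invr_ge0//.
rewrite gtr_pMl ?invr_gt0 ?ltr0n//.
have [ab|ab] := leqP a b.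
  rewrite distrC -natrB// normr_nat ltrn1; lia.
rewrite -natrB ?(ltnW ab)// normr_nat ltrn1; lia.
Qed.

Section NotPerturbedBisimilar.
Context (R : realType) (AP : countType) (n : nat) (eps delta : R).
Hypotheses (AP_inh : inhabited AP) (n_gt0 : (0 < n)%N) (eps_gt0 : 0 < eps).
Hypothesis eps_le : eps <= (n%:R * (n%:R + 1) ^+ 2)^-1.

(** Since [i * eps <= n * eps <= 1 / (n + 1)^2 <= 1], the truncation is inactive. *)
Lemma bias_valid (i : 'I_n.+1) : bias eps i = i%:R * eps.
Proof.
have nR : 0 < n%:R :> R by rewrite ltr0n.
have ine : i%:R * eps <= 1.
  apply: (@le_trans _ _ (n%:R * eps)).
    by rewrite ler_wpM2r ?(ltW eps_gt0)// ler_nat -ltnS.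
  apply: le_trans (ler_wpM2l (ltW nR) eps_le) _.
  rewrite invfM mulrA divff ?gt_eqF// mul1r invf_le1 ?exprn_gt0 ?addr_gt0//.
  by rewrite exprn_ege1// lerDr ltW.
by rewrite /bias min_r // max_r // mulr_ge0 // ltW.
Qed.

Lemma chain_not_perturbed_bisimilar :
  delta < n%:R * eps ->
  ~ perturbed_bisimilar (chain (AP := AP) n eps true) (chain n eps false) delta.
Proof.
move=> delta_lt [Rel pb init_rel].
have [[Rrefl Rsym Rtrans] _] := pb.
pose class (x : state n + state n) := [set y | Rel x y]%classic.
have classP x : equiv_class Rel (class x) by exists x.
have delta_small : delta < (n.+1 ^ 2)%:R^-1.
  apply: (lt_le_trans delta_lt).
  rewrite natrX -natr1 (le_trans (ler_wpM2l _ eps_le))//.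
  by rewrite invfM mulrA divff ?mul1r// pnatr_eq0 -lt0n.
(* Both initial states give the class of state 0 of the second chain a multiple of [1 / (n + 1)^2];
   differing by less than one unit, these masses are equal, which forces state [n] into the
   class. *)
have := perturbed_bisimulation_prob pb init_rel (classP (inr (inl ord0))).
rewrite sum_direct_sum_inl sum_direct_sum_inr !sum_state /=.
rewrite !if_same !addr0 -!mulr_suml -!natr_sum.
move=> /le_lt_trans /(_ delta_small) /(close_fractions_eq (d := n.+1 ^ 2) isT).
move=> /sum_weight_eq /(_ (mem_set (Rrefl _)) ord_max) /set_mem t0n.
(* States 0 and [n] reach the class of the labelled absorbing state with probabilities 0 and
   [n * eps]. *)
have := perturbed_bisimulation_prob pb t0n (classP (inr (inr (Some true)))).
have labelE x : x \in class (inr (inr (Some true))) ->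
    label (direct_sum (chain (AP := AP) n eps true) (chain n eps false)) x =
    [set: AP]%classic.
  by move=> /set_mem /(perturbed_bisimulation_label pb) <-.
have nb : inr (inr (Some false)) \notin class (inr (inr (Some true))).
  apply/negP => /labelE /=; case: AP_inh => p /seteqP[_ /(_ p)].
  exact.
have na : inr (inr (Some true)) \in class (inr (inr (Some true))).
  exact/mem_set/Rrefl.
rewrite !sum_direct_sum_inr !sum_state /= na (negbTE nb).
rewrite !big1// !if_same !add0r !addr0 !bias_valid mul0r sub0r normrN.
by rewrite ger0_norm ?mulr_ge0 ?(ltW eps_gt0)// leNgt delta_lt.
Qed.

End NotPerturbedBisimilar.

(** The sides differ only in the branching weights, all of which are positive. *)
Lemma chain_graph_isomorphic (R : realType) (AP : countType) (n : nat) (eps : R)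
    (s s' : bool) :
  graph_isomorphic (chain (AP := AP) n eps s) (chain n eps s').
Proof.
exists id; split; first by exists id.
by case=> [i|[b|]] [j|[b'|]] //; rewrite /edge /= !divr_gt0 ?ltr0n ?weight_gt0.
Qed.

Theorem theorem4p8 (R : realType) (AP : countType) (hAP : inhabited AP) :
  exists (S T : nat -> finType)
         (M : forall n : nat, R -> lmc R AP (S n))
         (N : forall n : nat, R -> lmc R AP (T n)),
    forall n : nat, (1 <= n)%N ->
    forall eps : R, 0 < eps -> eps <= (n%:R * (n%:R + 1) ^+ 2)^-1 ->
      [/\ graph_isomorphic (M n eps) (N n eps),
          eps_bisimilar (M n eps) (N n eps) eps &
          forall delta : R, 0 <= delta -> delta < n%:R * eps ->
            ~ perturbed_bisimilar (M n eps) (N n eps) delta].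
Proof.
exists state, state, (fun n eps => chain n eps true),
  (fun n eps => chain n eps false).
move=> n n_gt0 eps eps_gt0 eps_le; split.
- exact: chain_graph_isomorphic.
- exact/chain_eps_bisimilar/ltW.
- by move=> delta _; exact: chain_not_perturbed_bisimilar.
Qed.
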